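(* Let $K$ be an algebraically closed field. \begin{enumerate} \item Let $\operatorname{char} K=2$. Then $\beta_{\mathrm{sep}}(S_{3})=4$, where $S_3$ is the symmetric group on three letters. \item Let $\operatorname{char} K=p>0$ and let $G$ be a finite $p$-group. Then $\beta_{\mathrm{sep}}(G)=|G|$. \item Let $G$ be a finite cyclic group (and $K$ of arbitrary characteristic). Then $\beta_{\mathrm{sep}}(G)=|G|$. \item Assume $\operatorname{char} K=p$ is an odd prime and $r\ge 1$. Then $\beta_{\mathrm{sep}}(D_{2p^{r}})=2p^{r}$, where $D_{2n}$ denotes the dihedral group of order $2n$. \end{enumerate}
   Context: $D_{2n}=\langle\sigma,\rho\rangle$ is the dihedral group of order $2n$ with $\operatorname{ord}(\sigma)=2$, $\operatorname{ord}(\rho)=n$ and $\sigma\rho\sigma^{-1}=\rho^{-1}$. For a finite group $G$, a $G$-module is a finite dimensional $K$-vector space $V$ with a linear action of $G$. $\mathcal{O}(V)$ is the ring of polynomial functions on $V$, $\mathcal{O}(V)^{G}$ the subring of $G$-invariant functions, and $\mathcal{O}(V)^G_{\le d}$ the space of $G$-invariant polynomial functions of degree at most $d$. A subset $S\subset\mathcal{O}(V)^{G}$ is called $G$-separating if for all $x,x'\in V$: whenever $f(x)\ne f(x')$ for some $f\in\mathcal{O}(V)^{G}$, there is $h\in S$ with $h(x)\ne h(x')$. Define $$\beta_{\mathrm{sep}}(G,V)=\min\{d\mid \mathcal{O}(V)^{G}_{\le d}\text{ is }G\text{-separating}\}\in\mathbb{N},\qquad \beta_{\mathrm{sep}}(G)=\sup\{\beta_{\mathrm{sep}}(G,V)\mid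 V \text{ a } G\text{-module}\}\in\mathbb{N}\cup\{\infty\}.$$ *)

(* Defs.v *)
From HB Require Import structures.
From mathcomp Require Import all_boot all_order all_algebra all_fingroup.
From mathcomp Require Import all_solvable all_character.
From mathcomp Require Import boolp mpoly.

Set Implicit Arguments.
Unset Strict Implicit.
Unset Printing Implicit Defensive.

Import GroupScope GRing.Theory.
Local Open Scope ring_scope.

(* A G-module of dimension n is a matrix representation of G of degree n, the
   space being V = 'rV[K]_n with g acting by x |-> x *m rG g.  This is a right
   action; it becomes a left action through g |-> g^-1, which changes neither
   the orbits nor the invariants.  Since K is infinite, O(V) is identified with
   {mpoly K[n]}, the degree being the total degree. *)
Section SeparatingDegree.

Variables (K : closedFieldType) (gT : finGroupType) (G : {group gT}).

Definition mpeval n (f : {mpoly K[n]}) (x : 'rV[K]_n) : K :=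
  f.@[fun i => x 0 i].

Section Module.

Variables (n : nat) (rG : mx_representation K G n).

Definition invariant (f : {mpoly K[n]}) : Prop :=
  forall g x, g \in G -> mpeval f (x *m rG g) = mpeval f x.

(* msize f is deg f + 1 for f != 0, and 0 for f = 0. *)
Definition invariant_le (d : nat) (f : {mpoly K[n]}) : Prop :=
  invariant f /\ (msize f <= d.+1)%N.

Definition separating (S : {mpoly K[n]} -> Prop) : Prop :=
  (forall f, S f -> invariant f) /\
  (forall x x' : 'rV[K]_n,
     (exists f, invariant f /\ mpeval f x <> mpeval f x') ->
     exists h, S h /\ mpeval h x <> mpeval h x').

Definition separating_degree (d : nat) : bool :=
  `[< separating (invariant_le d) >].

(* The norm of an affine function that vanishes at x' but nowhere on the orbit
   of x is an invariant of degree at most #|G|. *)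
Lemma separating_degree_exists : exists d, separating_degree d.
Proof.
exists #|G|; apply/asboolP; split=> [f [] // | x x' [f [fG fxx']]].
pose q := \prod_(g in G) rVpoly (x *m rG g - x').
have q_neq0 : q != 0.
  apply/prodf_neq0 => g gG; apply: contra_notN fxx'.
  move=> /eqP /(congr1 (poly_rV (d := n))).
  by rewrite rVpolyK linear0 => /subr0_eq <-; rewrite fG.
have [t] := closed_nonrootP _ q_neq0; rewrite /root horner_prod => qt.
pose L g : {mpoly K[n]} :=
  \sum_(i < n) t ^+ i *: (\sum_(j < n) rG g j i *: 'X_j - (x' 0 i)%:MP).
have evalL g y : mpeval (L g) y = (rVpoly (y *m rG g - x')).[t].
  rewrite (horner_coef_wide _ (size_poly _ _)) /mpeval /L raddf_sum /=.
  apply: eq_bigr => i _; rewrite coef_rVpoly_ord !mxE mevalZ mevalB mevalC.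
  rewrite mulrC raddf_sum; congr ((_ - _) * _).
  by apply: eq_bigr => j _; rewrite /= mevalZ mevalXU mulrC.
have sizeL g : (msize (L g) <= 2)%N.
  apply: leq_trans (mmeasure_sum _ _ _ _) _; apply/bigmax_leqP => i _.
  apply: leq_trans (msizeZ_le _ _) _; apply: leq_trans (mmeasureD_le _ _ _) _.
  rewrite geq_max mmeasureN mmeasureC (leq_trans (leq_b1 _)) // andbT.
  apply: leq_trans (mmeasure_sum _ _ _ _) _; apply/bigmax_leqP => j _.
  by apply: leq_trans (msizeZ_le _ _) _; rewrite msizeX mdeg1.
pose h := \prod_(g in G) L g.
have evalh y : mpeval h y = \prod_(g in G) (rVpoly (y *m rG g - x')).[t].
  by rewrite /mpeval rmorph_prod; apply: eq_bigr => g _; apply: evalL.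
exists h; split; last first.
  rewrite !evalh [in X in _ <> X](bigD1 1%g) //= repr_mx1 mulmx1 subrr.
  by rewrite linear0 horner0 mul0r; apply/eqP.
split=> [g y gG|].
  rewrite !evalh [RHS](reindex_inj (mulgI g)) /=.
  apply: eq_big => [k|k kG]; first by rewrite groupMl.
  by rewrite repr_mxM // mulmxA.
rewrite /h -big_enum /= cardE.
elim: (enum _) => [|g s IHs]; first by rewrite big_nil msize1.
rewrite big_cons; have [->|nzL] := eqVneq (L g) 0.
  by rewrite mul0r mmeasure0.
have [->|nzP] := eqVneq (\prod_(j <- s) L j) 0; first by rewrite mulr0 mmeasure0.
by rewrite msizeM //; have := leq_add (sizeL g) IHs; case: (_ + _)%N.
Qed.

Definition beta_sep_mod : nat := ex_minn separating_degree_exists.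

End Module.

Definition beta_sep_bound (m : nat) : bool :=
  `[< forall (n : nat) (rG : mx_representation K G n),
        (beta_sep_mod rG <= m)%N >].

(* A supremum in N + {oo}, where oo is None. *)
Definition beta_sep : option nat :=
  if pselect (exists m, beta_sep_bound m) is left bounded
  then Some (ex_minn bounded) else None.

End SeparatingDegree.

(* Main.v *)
(* Invariants of a finite group separate orbits, and the norm of an affine
   function shows that degree |G| always suffices.

   For the lower bounds in (2)-(4), let a p-subgroup P act transitively on n
   points, and let G act on K^n by these permutations twisted by a linear
   character chi of order m prime to p.  The coefficients of an invariant are
   constant on P-orbits of monomials, whose lengths vanish in K unless they are
   1, so at the all-ones vector only the monomials (x_1 ... x_n)^k contribute;
   invariance under chi forces m | k.  Hence the all-ones vector is separated
   from 0 only in degree at least nm.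

   For S_3 in characteristic 2, split V under the 3-cycle into its fixed space
   and its two eigenspaces, which are exchanged by the involution.  Invariant
   sums of products of at most four coordinates of the components separate
   orbits.
   Cubics do not suffice: let c be fixed by the 3-cycle, let d be an eigenvector
   for a primitive cube root of unity w, and let f be a cubic invariant.  Then
   f(c + td) - f(td) has degree at most 2 in t and takes the same value at the
   cube roots of unity, so f(c + d) = f(c) - f(0) + f(d), which does not change
   when d is replaced by its image under the involution. *)
Require Import Defs.
From mathcomp Require Import all_boot all_order all_algebra all_fingroup.
From mathcomp Require Import all_solvable all_character.
From mathcomp Require Import all_field boolp ring mpoly.

Set Implicit Arguments.
Unset Strict Implicit.
Unset Printing Implicit Defensive.

Import GRing.Theory.

(** * Polynomial functions of bounded degree *)

Section PolynomialFunctions.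

Local Open Scope ring_scope.

Variables (K : closedFieldType) (n : nat).
Implicit Types (F : 'rV[K]_n -> K) (f : {mpoly K[n]}).

(** Working with functions lets invariants be written in eigencoordinates and their invariance be
    checked pointwise. *)
Definition poly_fun d F := exists2 f, (msize f <= d.+1)%N & mpeval f =1 F.

Lemma poly_fun_linear m (A : 'M_(n, m)) j : poly_fun 1 (fun x => (x *m A) 0 j).
Proof.
exists (\sum_(i < n) A i j *: 'X_i) => [|x].
  apply: leq_trans (mmeasure_sum _ _ _ _) _; apply/bigmax_leqP => i _.
  by apply: leq_trans (msizeZ_le _ _) _; rewrite msizeX mdeg1.
rewrite /mpeval raddf_sum mxE; apply: eq_bigr => i _.
by rewrite /= mevalZ mevalXU mulrC.
Qed.

Lemma poly_funD d F1 F2 :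
  poly_fun d F1 -> poly_fun d F2 -> poly_fun d (fun x => F1 x + F2 x).
Proof.
move=> [f1 sf1 Ef1] [f2 sf2 Ef2]; exists (f1 + f2) => [|x].
  by apply: leq_trans (msizeD_le _ _) _; rewrite geq_max sf1.
by rewrite -Ef1 -Ef2 /mpeval mevalD.
Qed.

Lemma poly_funM d1 d2 F1 F2 :
  poly_fun d1 F1 -> poly_fun d2 F2 -> poly_fun (d1 + d2) (fun x => F1 x * F2 x).
Proof.
move=> [f1 sf1 Ef1] [f2 sf2 Ef2]; exists (f1 * f2) => [|x]; last first.
  by rewrite -Ef1 -Ef2 /mpeval mevalM.
have [->|nz1] := eqVneq f1 0; first by rewrite mul0r mmeasure0.
have [->|nz2] := eqVneq f2 0; first by rewrite mulr0 mmeasure0.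
by rewrite msizeM //; have := leq_add sf1 sf2; rewrite addSn addnS;
  case: (_ + _)%N.
Qed.

Lemma poly_funC d c : poly_fun d (fun=> c).
Proof.
exists c%:MP => [|x]; last by rewrite /mpeval mevalC.
by rewrite mmeasureC (leq_trans (leq_b1 _)).
Qed.

Lemma poly_fun_prod I (r : seq I) (F : I -> 'rV[K]_n -> K) :
  (forall i, poly_fun 1 (F i)) ->
  poly_fun (size r) (fun x => \prod_(i <- r) F i x).
Proof.
move=> dF; elim: r => [|i r [f sf Ef]].
  by have [f sf Ef] := poly_funC 0 1; exists f => // x; rewrite big_nil.
have [g sg Eg] := poly_funM (dF i) (ex_intro2 _ _ f sf Ef).
by exists g => // x; rewrite Eg big_cons.
Qed.

(** The remainder modulo [b] recovers the lowest digit, and cancelling [b] leaves the higher ones.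
    This keeps the Kronecker exponents of distinct monomials apart. *)
Lemma radix_inj b (m1 m2 : 'I_n -> nat) :
    (forall i, m1 i < b)%N -> (forall i, m2 i < b)%N ->
    (\sum_i m1 i * b ^ i = \sum_i m2 i * b ^ i)%N -> m1 =1 m2.
Proof.
elim: n m1 m2 => [|k IHk] m1 m2 lt1 lt2 E12; first by case.
have sumE (m : 'I_k.+1 -> nat) :
    (\sum_i m i * b ^ i =
       (\sum_(i < k) m (lift ord0 i) * b ^ i) * b + m ord0)%N.
  rewrite big_ord_recl muln1 addnC big_distrl; congr (_ + _)%N.
  by apply: eq_bigr => i _; rewrite lift0 expnSr mulnA.
have [d1 d2]: m1 ord0 = m2 ord0 /\
    (\sum_(i < k) m1 (lift ord0 i) * b ^ i =
     \sum_(i < k) m2 (lift ord0 i) * b ^ i)%N.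
  rewrite !sumE in E12.
  have := congr1 (modn^~ b) E12; rewrite !modnMDl !modn_small // => e0.
  split=> //; move: E12; rewrite e0 => /addIn/eqP.
  by rewrite eqn_pmul2r ?(leq_ltn_trans _ (lt1 ord0)) // => /eqP.
move=> i; have [j ->|->] := unliftP ord0 i; last by [].
by apply: (IHk (m1 \o lift ord0) (m2 \o lift ord0)) => // k0 /=.
Qed.

(* Kronecker substitution X_i := t ^ (b ^ i), with b above all exponents. *)
Lemma mpeval_inj f g : mpeval f =1 mpeval g -> f = g.
Proof.
move=> Efg; apply/eqP; rewrite -subr_eq0; apply/eqP.
have {Efg}: forall x, mpeval (f - g) x = 0.
  by move=> x; have := Efg x; rewrite /mpeval mevalB => ->; rewrite subrr.
move: (f - g) => {f g} f f0; apply/mpolyP => m0; rewrite mcoeff0.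
pose b := msize f; pose e (m : 'X_{1..n}) := (\sum_(i < n) m i * b ^ i)%N.
pose q := \sum_(m <- msupp f) f@_m *: 'X^(e m) : {poly K}.
have q0: q = 0.
  apply/eqP; apply: contraT => /closed_nonrootP[t /negP[]].
  rewrite /root -(f0 (\row_i t ^+ (b ^ i))) /mpeval mevalE /q horner_sum.
  apply/eqP/eq_bigr => m _; rewrite hornerZ hornerXn; congr (_ * _).
  by rewrite expr_sum; apply: eq_bigr => i _; rewrite mxE mulnC exprM.
(* The exponents [e m] are distinct on the support, so the coefficient of [q] at [e m0] is that of
   [f] at [m0]. *)
apply/eqP; apply: contraT; rewrite -mcoeff_msupp => fm0.
have := congr1 (fun p : {poly K} => p`_(e m0)) q0.
rewrite coef0 coef_sum (bigD1_seq m0) ?msupp_uniq //= coefZ coefXn eqxx mulr1.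
rewrite big1_seq ?addr0 => [/eqP|m /andP[mm0 fm]].
  by rewrite mcoeff_eq0 fm0.
rewrite coefZ coefXn; case: eqP => [Em|]; last by rewrite mulr0.
have lt_b m' i : m' \in msupp f -> (m' i < b)%N.
  by move/msize_mdeg_lt; apply: leq_ltn_trans;
    rewrite mdegE (bigD1 i) //= leq_addr.
case/eqP: mm0; apply/mnmP; apply: (radix_inj (b := b)) => [i|i|];
  rewrite ?lt_b //.
Qed.

End PolynomialFunctions.

(** * General bounds for the separating degree *)

Section Beta.

Local Open Scope ring_scope.

Variables (K : closedFieldType) (gT : finGroupType) (G : {group gT}).

Lemma beta_sep_eq N :
    (forall n (rG : mx_representation K G n), beta_sep_mod rG <= N)%N ->
    (exists n (rG : mx_representation K G n), N <= beta_sep_mod rG)%N ->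
  beta_sep K G = Some N.
Proof.
move=> leN [n [rG geN]]; rewrite /beta_sep; case: pselect => [ex|]; last first.
  by case; exists N; apply/asboolP.
congr Some; case: ex_minnP => m /asboolP le_m min_m; apply/eqP.
rewrite eqn_leq min_m ?(leq_trans geN) //; exact/asboolP.
Qed.

Variables (n : nat) (rG : mx_representation K G n).

(** Invariants are constant on orbits, so it suffices that those of degree at most [d] tell orbits
    apart. *)
Lemma beta_sep_mod_le d :
    (forall x x', (forall F, poly_fun d F ->
        (forall g y, g \in G -> F (y *m rG g) = F y) -> F x = F x') ->
      exists2 g, g \in G & x' = x *m rG g) ->
  (beta_sep_mod rG <= d)%N.
Proof.
move=> sep; rewrite /beta_sep_mod; case: ex_minnP => m _; apply.
apply/asboolP; split=> [f [] // | x x' [f [fG fxx']]].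
apply: contrapT => no_h; apply: fxx'.
have [F [h sh Eh] FG|g gG ->] := sep x x'; last by rewrite fG.
apply: contrapT => Fxx'; apply: no_h; exists h; rewrite !Eh; split=> //.
by split=> // g y gG; rewrite !Eh FG.
Qed.

Lemma leq_beta_sep_mod d x x' f :
    Defs.invariant rG f -> mpeval f x <> mpeval f x' ->
    (forall h, invariant_le rG d h -> mpeval h x = mpeval h x') ->
  (d < beta_sep_mod rG)%N.
Proof.
move=> fG fxx' eq_h; rewrite /beta_sep_mod; case: ex_minnP =>
  m /asboolP[_ sep] _.
rewrite ltnNge; apply/negP => le_md; have [|h [[hG sh] []]] := sep x x'.
  by exists f.
by apply: eq_h; split=> //; apply: leq_trans sh _.
Qed.

(* The norm of an affine function that vanishes at x' but nowhere on the orbit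
   of x separates x from x'. *)
Lemma orbit_separation x x' :
    (forall g, g \in G -> x' <> x *m rG g) ->
  exists2 f, invariant_le rG #|G| f & mpeval f x <> mpeval f x'.
Proof.
(* Reading vectors as coefficient lists, evaluation at [t] is the linear functional with weights 1,
   t, t^2, and so on. A non-root [t] of [q] gives one functional that vanishes at none of the
   vectors [x *m rG g - x']. *)
move=> xx'; pose q := \prod_(g in G) rVpoly (x *m rG g - x').
have /closed_nonrootP[t] : q != 0.
  apply/prodf_neq0 => g gG; apply: contra_notN (xx' g gG).
  move=> /eqP /(congr1 (poly_rV (d := n))).
  by rewrite rVpolyK linear0 => /subr0_eq <-.
rewrite /root horner_prod => qt.
pose L g (y : 'rV_n) := (rVpoly (y *m rG g - x')).[t].
have dL g : poly_fun 1 (L g).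
  have [f sf Ef] := poly_funD
    (poly_fun_linear (rG g *m \col_i t ^+ i) 0)
    (poly_funC _ 1 (- (x' *m \col_i t ^+ i) 0 0)).
  exists f => // y; rewrite Ef /L (horner_coef_wide _ (size_poly _ _)) mulmxA.
  rewrite -[_ - _]/(_ + (- _)) !mxE -sumrB; apply: eq_bigr => i _.
  by rewrite coef_rVpoly_ord !mxE mulrBl.
have [f sf fE] := poly_fun_prod (enum G) dL.
have {}fE y : mpeval f y = \prod_(g in G) L g y by rewrite fE big_enum.
exists f; last first.
  rewrite !fE [in X in _ <> X](bigD1 1%g) //= {2}/L repr_mx1 mulmx1 subrr.
  by rewrite linear0 horner0 mul0r; apply/eqP.
split=> [h y hG|]; last by rewrite cardE.
rewrite !fE [RHS](reindex_inj (mulgI h)) /=.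
apply: eq_big => [k|k kG]; first by rewrite groupMl.
by rewrite /L repr_mxM // mulmxA.
Qed.

Lemma beta_sep_mod_le_card : (beta_sep_mod rG <= #|G|)%N.
Proof.
apply: beta_sep_mod_le => x x' eqF; apply: contrapT => xx'.
have [g gG x'E|f [fG sf]] := @orbit_separation x x'; first by apply: xx';
  exists g.
by case; apply: eqF => //; exists f.
Qed.

End Beta.

(** * Coefficients of invariants under twisted permutations *)

Section TwistedPermutation.

Local Open Scope ring_scope.

(** Orbit lengths are powers of the characteristic, so an orbit contributes 0 unless it is a single
    point. In characteristic 0 the hypothesis makes [P] trivial. *)
Lemma sum_pgroup_fix (K : fieldType) (aT : finGroupType) (T : finType)
    (to : {action aT &-> T}) (P : {group aT}) (F : T -> K) :
    ([pchar K].-group P)%g ->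
    (forall a x, a \in P -> F (to x a) = F x) ->
  \sum_x F x = \sum_(x in 'Fix_to(P)%g) F x.
Proof.
move=> pP FP; pose S := orbit to P @: [set: T].
have partS : partition S [set: T] by apply: orbit_partition;
  apply/actsP => a _ x; rewrite !inE.
have trS := partition_trivIset partS; have covS := cover_partition partS.
have sum_cover (E : T -> K) : \sum_x E x = \sum_(A in S) \sum_(x in A) E x.
  by rewrite -big_trivIset ?covS //; apply: eq_bigl => x; rewrite inE.
rewrite [RHS]big_mkcond !sum_cover; apply: eq_bigr => _ /imsetP[x _ ->].
have [fix_x|nfix_x] := boolP (x \in 'Fix_to(P)%g).
  by apply: eq_bigr => y /orbitP[a Pa <-]; rewrite (afixP fix_x a Pa) fix_x.
rewrite (eq_bigr (fun=> F x)) => [|y /orbitP[a Pa <-]]; last by rewrite FP.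
rewrite [RHS]big1 => [|y xy]; last first.
  rewrite ifN //; apply: contra nfix_x => fix_y.
  by move: xy; rewrite orbit_sym => /orbitP[a Pa <-];
    rewrite (afixP fix_y a Pa).
rewrite sumr_const -mulr_natr; suff -> :
  #|orbit to P x|%:R = 0 :> K by rewrite mulr0.
(* A length that is nonzero in [K] is prime to the characteristic; dividing the order of [P], it
   must be 1. *)
apply/eqP; rewrite -[_ == 0]negbK natf_neq0_pchar; apply: contra nfix_x => p'O.
have pO : [pchar K].-nat #|orbit to P x| by apply:
  pnat_dvd (dvdn_orbit _ _ _) pP.
have /card1P[z Oz] : #|orbit to P x| == 1%N.
  by rewrite -[_ == _]/(_ == 1)%N -(pnat_1 pO p'O).
apply/afixP => a Pa; apply/eqP.
by move: (Oz x) (Oz (to x a)); rewrite orbit_refl mem_orbit // !inE =>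
  /esym/eqP-> /esym.
Qed.

Variables (K : closedFieldType) (n : nat).
Implicit Types (s : 'S_n) (f : {mpoly K[n]}).

Local Notation mperm m s := [multinom m (s%g i) | i < n].

(** Scaling the variables multiplies coefficients by powers of [c], and permuting them permutes
    exponents. Polynomials with equal values are equal, so coefficients can be compared. *)
Lemma mcoeff_monomial_invariant c s f :
    (forall x, mpeval f (x *m (c *: perm_mx s)) = mpeval f x) ->
  forall m : 'X_{1..n}, f@_(mperm m s) = c ^+ mdeg m * f@_m.
Proof.
move=> fcs m.
(* [fc] is f(c x), given by its coefficients. *)
pose fc := \sum_(m <- msupp f) (c ^+ mdeg m * f@_m) *: 'X_[m].
have fcE k : fc@_k = c ^+ mdeg k * f@_k.
  rewrite raddf_sum /=; under eq_bigr do rewrite mcoeffZ mcoeffX.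
  have [fk|/memN_msupp_eq0 fk] := boolP (k \in msupp f).
    rewrite (bigD1_seq k) ?msupp_uniq //= eqxx mulr1 big1 ?addr0 // => l.
    by move/negPf->; rewrite mulr0.
  rewrite fk mulr0; apply: big1 => l _; case: eqP => [->|];
    last by rewrite mulr0.
  by rewrite fk mulr0 mul0r.
have fc_eval (x : 'rV_n) : mpeval fc x = mpeval f (c *: x).
  rewrite /mpeval raddf_sum mevalE; apply: eq_bigr => l _ /=.
  rewrite mevalZ mevalX mdegE -prodrXr mulrAC [LHS]mulrC -big_split.
  by congr (_ * _); apply: eq_bigr => i _; rewrite mxE exprMn.
have Ef : f = msym s^-1%g fc.
  apply: mpeval_inj => x; rewrite -fcs -scalemxAr -fc_eval.
  rewrite -[in perm_mx _](invgK s) -col_permE.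
  rewrite /msym /mpeval (mpolyE fc) [mmap _ _ _]raddf_sum !raddf_sum /=.
  apply: eq_bigr => l _; rewrite mmapZ mmapX mevalM mevalC mevalZ mevalX;
    congr (_ * _).
  rewrite rmorph_prod; apply: eq_bigr => i _ /=.
  by rewrite rmorphXn /= mevalXU mxE.
rewrite {1}Ef mcoeff_sym fcE; congr (c ^+ _ * f@__); last first.
  by apply/mnmP => i; rewrite !mnmE permKV.
by rewrite !mdeg_mperm.
Qed.

(** Summing over all bounded exponents, not only the support, gives a finite index type on which a
    group can act. *)
Lemma mpeval_const1 f :
  mpeval f (const_mx 1) = \sum_(m : 'X_{1..n < msize f}) f@_m.
Proof.
rewrite /mpeval {1}(mpolywE (leqnn (msize f))) raddf_sum; apply: eq_bigr => m _.
by rewrite /= mevalZ mevalX big1 ?mulr1 // => i _; rewrite mxE expr1n.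
Qed.

Lemma mpeval_const0 f :
  mpeval f 0 =
    \sum_(m : 'X_{1..n < msize f}) f@_m * (m == 0%MM :> 'X_{1..n})%:R.
Proof.
rewrite /mpeval {1}(mpolywE (leqnn (msize f))) raddf_sum; apply: eq_bigr => m _.
rewrite /= mevalZ mevalX -mdeg_eq0 -expr0n mdegE -prodrXr; congr (_ * _).
by apply: eq_bigr => i _; rewrite mxE.
Qed.

(** The inverse makes this a right action, as [action] requires. *)
Lemma mperm_act b : exists to : {action 'S_n &-> 'X_{1..n < b}},
  forall (m : 'X_{1..n < b}) s, to m s = mperm m s^-1 :> 'X_{1..n}.
Proof.
have lt_b (m : 'X_{1..n < b}) s : (mdeg (mperm m s) < b)%N.
  by rewrite mdeg_mperm bmdeg.
pose to (m : 'X_{1..n < b}) s : 'X_{1..n < b} := BMultinom (lt_b m s^-1%g).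
have to1 : to^~ 1%g =1 id.
  by move=> m; apply/val_inj/mnmP => i; rewrite /= mnmE invg1 perm1.
have toM m : act_morph to m.
  by move=> s t; apply/val_inj/mnmP => i; rewrite /= !mnmE invMg permM.
by exists (TotalAction to1 toM).
Qed.

(** At the all-ones vector only exponents fixed by [P] contribute, and transitivity makes these
    constant. If only the zero exponent contributed, both values would be the constant term. *)
Lemma transitive_pgroup_fixed_monomial (P : {group 'S_n}) f :
    ([pchar K].-group P)%g -> (forall i j, exists2 s, s \in P & s i = j) ->
    (forall s (m : 'X_{1..n}), s \in P -> f@_(mperm m s) = f@_m) ->
    mpeval f (const_mx 1) <> mpeval f 0 ->
  exists k, [/\ (0 < k)%N, (n * k < msize f)%N & f@_[multinom k | _ < n] != 0].
Proof.
move=> pP trP fP; apply: contra_notP => no_k;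
  rewrite mpeval_const1 mpeval_const0.
have [to toE] := mperm_act (msize f).
rewrite (sum_pgroup_fix (to := to) (F := fun m : 'X_{1..n < msize f} =>
  f@_m) pP) => [|s m Ps]; last first.
  by rewrite toE fP ?groupV.
rewrite big_mkcond; apply: eq_bigr => m _.
have [m0|nz_m] := eqVneq (m : 'X_{1..n}) 0%MM.
  rewrite mulr1 ifT //; apply/afixP => s _; apply: val_inj.
  apply: etrans (toE m s) (etrans _ (esym m0)).
  by rewrite m0; apply/mnmP => i; rewrite !mnmE.
rewrite mulr0; case: ifP => // /afixP fix_m; apply/eqP; apply: contraT => fm.
have /existsP[i mi] : [exists i, m i != 0%N].
  apply: contraR nz_m => /existsPn m0.
  by apply/eqP/mnmP => i; rewrite mnmE; apply/eqP/negPn.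
have m_const : m = [multinom m i | _ < n] :> 'X_{1..n}.
  apply/mnmP => j; have [s Ps si] := trP j i.
  by rewrite -{1}(fix_m _ (groupVr Ps)) toE !mnmE invgK si.
case: no_k; exists (m i); rewrite lt0n mi -m_const fm.
have := bmdeg m; rewrite {1}m_const mdegE; under eq_bigr do rewrite mnmE.
by rewrite sum_nat_const card_ord => ->.
Qed.

End TwistedPermutation.

(** * Lower bounds from twisted permutation modules *)

Section TwistedRepresentation.

Local Open Scope ring_scope.

Variables (K : closedFieldType) (gT : finGroupType) (G : {group gT}).

(** The [m]-th power of the product of the coordinates separates the all-ones vector from 0. An
    invariant of degree below [n * m] that did so would contain a monomial with constant exponent
    [k], [0 < k < m], but the twist forces [m] to divide [k]. *)
Lemma twisted_perm_beta n m (rG : mx_representation K G n) (P : {group gT})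
    (phi : {morphism G >-> 'S_n}) (chi : gT -> K) :
    {in G, forall g, rG g = chi g *: perm_mx (phi g)} ->
    (0 < n)%N -> P \subset G -> ([pchar K].-group P)%g ->
    (forall i j, exists2 g, g \in P & phi g i = j) ->
    {in P, forall g, chi g = 1} -> {in G, forall g, chi g ^+ m = 1} ->
    (exists2 g, g \in G & m.-primitive_root (chi g)) ->
  (n * m <= beta_sep_mod rG)%N.
Proof.
move=> rGE n_gt0 sPG pP trP chiP chim [g0 Gg0 prim_m].
have m_gt0 := prim_order_gt0 prim_m.
(* [n] is an orbit length of a group of characteristic-power order, hence prime to the order [m] of
   a root of unity. *)
have n_p : [pchar K].-nat n.
  have o_dvd : orbit 'P (phi @* P)%g (Ordinal n_gt0) = setT.
    apply/setP => j; rewrite inE; have [g Pg <-] := trP (Ordinal n_gt0) j.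
    by apply: (@mem_orbit _ _ _ 'P _ _ (phi g));
      rewrite mem_morphim // (subsetP sPG).
  have := @dvdn_orbit _ _ 'P (phi @* P)%G (Ordinal n_gt0).
  rewrite o_dvd cardsT card_ord => /pnat_dvd; apply.
  exact: morphim_pgroup.
have co_mn : coprime m n by rewrite coprime_sym (pnat_coprime n_p)
  ?(pchar_prim_root prim_m).
have coef_inv f g (k : 'X_{1..n}) : Defs.invariant rG f -> g \in G ->
    f@_[multinom k (phi g i) | i < n] = chi g ^+ mdeg k * f@_k.
  by move=> fG Gg; apply: mcoeff_monomial_invariant => x; rewrite -rGE // fG.
pose h := (\prod_(i < n) 'X_i) ^+ m : {mpoly K[n]}.
have hE x : mpeval h x = \prod_(i < n) x 0 i ^+ m.
  rewrite /mpeval rmorphXn rmorph_prod -prodrXl; apply: eq_bigr => i _.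
  by rewrite /= mevalXU.
have hG : Defs.invariant rG h.
  move=> g x Gg; rewrite !hE (reindex_inj (@perm_inj _ (phi g))) /=.
  apply: eq_bigr => i _; rewrite rGE // -scalemxAr mxE exprMn chim // mul1r.
  by rewrite -[X in perm_mx X]invgK -col_permE mxE permK.
have h10 : mpeval h (const_mx 1) <> mpeval h 0.
  rewrite !hE big1 => [|i _]; last by rewrite mxE expr1n.
  rewrite (bigD1 (Ordinal n_gt0)) //= mxE expr0n gtn_eqF // mul0r.
  by apply/eqP/oner_neq0.
have nm_gt0 : (0 < n * m)%N by rewrite muln_gt0 n_gt0.
rewrite -(prednK nm_gt0); apply: leq_beta_sep_mod hG h10 _ => f [fG sf].
apply: contrapT => f10.
have [||_ k /morphimP[g Gg Pg ->] |k [k_gt0 lt_nk fk]] :=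
  @transitive_pgroup_fixed_monomial _ _ (phi @* P)%G f _ _ _ f10.
- exact: morphim_pgroup.
- move=> i j; have [g Pg <-] := trP i j.
  by exists (phi g) => //; rewrite mem_morphim // (subsetP sPG).
- by rewrite coef_inv // chiP // expr1n mul1r.
have mdeg_k : mdeg [multinom k | _ < n] = (n * k)%N.
  by rewrite mdegE; under eq_bigr do rewrite mnmE;
    rewrite sum_nat_const card_ord.
(* A constant exponent is fixed by every permutation, so [chi g0] to the power [n * k] is 1. *)
have m_dvd : (m %| n * k)%N.
  rewrite (prim_order_dvd prim_m) -mdeg_k; apply/eqP/(mulIf fk).
  rewrite mul1r -coef_inv //; congr (f@__).
  by apply/mnmP => i; rewrite !mnmE.
rewrite Gauss_dvdr // in m_dvd.
have := leq_trans lt_nk sf; rewrite prednK // ltn_pmul2l // ltnNge.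
by rewrite (dvdn_leq k_gt0 m_dvd).
Qed.

Lemma acts_perm_morphism (T : finType) (to : {action gT &-> T}) (X : {set T}) :
    [acts G, on X | to] ->
  exists phi : {morphism G >-> 'S_#|X|},
    {in G, forall g i, enum_val (phi g i) = to (enum_val i) g}.
Proof.
move=> actX; have [->|[x0 Xx0]] := set_0Vmem X.
  have GM : {in G &, {morph (fun=> 1%g : 'S_#|@set0 T|) : g h / (g * h)%g}}.
    by move=> g h _ _; rewrite mulg1.
  by exists (Morphism GM) => g _ i; have := enum_valP i; rewrite inE.
(* Elements outside [G] act trivially, so that [f g] is a permutation for every [g]. *)
pose g' g := if g \in G then g else 1%g.
have Gg' g : g' g \in G by rewrite /g'; case: ifP.
pose f g (i : 'I_#|X|) := enum_rank_in Xx0 (to (enum_val i) (g' g)).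
have fE g i : enum_val (f g i) = to (enum_val i) (g' g).
  by rewrite enum_rankK_in // (acts_act actX) // enum_valP.
have f_inj g : injective (f g).
  move=> i j /(congr1 enum_val); rewrite !fE => /act_inj.
  exact: enum_val_inj.
have GM : {in G &, {morph (fun g => perm (@f_inj g)) : g h / (g * h)%g}}.
  move=> g h Gg Gh; apply/permP => i; apply: enum_val_inj.
  by rewrite permM !permE !fE /g' groupM // Gg Gh actM.
exists (Morphism GM) => g Gg i.
by rewrite /= permE fE /g' Gg.
Qed.

Lemma twisted_perm_repr n (phi : {morphism G >-> 'S_n}) (chi : gT -> K) :
    chi 1%g = 1 -> {in G &, {morph chi : g h / (g * h)%g >-> g * h}} ->
  exists rG : mx_representation K G n,
    {in G, forall g, rG g = chi g *: perm_mx (phi g)}.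
Proof.
move=> chi1 chiM.
have reprG : mx_repr G (fun g => chi g *: perm_mx (phi g)).
  split=> [|g h Gg Gh]; first by rewrite chi1 morph1 perm_mx1 scale1r.
  by rewrite chiM // morphM // perm_mxM -scalemxAl -scalemxAr scalerA.
by exists (MxRepresentation reprG).
Qed.

(** The module is the permutation module on the cosets of [H] twisted by [chi], that is, the one
    induced from the restriction of [chi] to [H]. *)
Lemma induced_linear_beta (H P : {group gT}) (chi : gT -> K) m :
    H \subset G -> P \subset G -> (H * P)%g = G -> ([pchar K].-group P)%g ->
    {in G &, {morph chi : g h / (g * h)%g >-> g * h}} ->
    {in G, forall g, chi g ^+ m = 1} ->
    (exists2 g, g \in G & m.-primitive_root (chi g)) ->
  exists n (rG : mx_representation K G n),
    (#|G : H|%g * m <= beta_sep_mod rG)%N.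
Proof.
move=> sHG sPG defG pP chiM chim [g0 Gg0 prim_m].
have m_gt0 := prim_order_gt0 prim_m.
have chi_neq0 g : g \in G -> chi g != 0.
  move/chim => cgm; apply/eqP => cg0; move: cgm.
  by rewrite cg0 expr0n gtn_eqF // => /esym/eqP; rewrite oner_eq0.
have chi1 : chi 1%g = 1.
  by apply: (mulfI (chi_neq0 _ (group1 G))); rewrite -chiM // mulg1 mulr1.
have chiX g k : g \in G -> chi (g ^+ k)%g = chi g ^+ k.
  by move=> Gg; elim: k => // k IHk; rewrite expgS exprS chiM ?groupX ?IHk.
(* The order of such a value divides both [m] and the order of [P], which are coprime. *)
have chiP : {in P, forall g, chi g = 1}.
  move=> g Pg; have Gg := subsetP sPG g Pg.
  have [i chi_g] := prim_rootP prim_m (chim g Gg).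
  apply/eqP; rewrite chi_g -(prim_order_dvd prim_m).
  have : coprime m #|P| by rewrite coprime_sym (pnat_coprime pP)
    ?(pchar_prim_root prim_m).
  move/Gauss_dvdl => <-; rewrite (prim_order_dvd prim_m) exprM -chi_g -chiX //.
  by rewrite expg_cardG // chi1.
have actG := actsRs_rcosets H G.
have [phi phiE] := acts_perm_morphism actG.
have [rG rGE] := twisted_perm_repr phi chi1 chiM.
exists _, rG; apply: (twisted_perm_beta rGE) chiP chim _ => //;
  last by exists g0.
  exact: indexg_gt0.
have HX : (H : {set gT}) \in rcosets H G by apply/rcosetsP; exists 1%g;
  rewrite ?mulg1.
(* The stabiliser of the coset [H] is [H], so [P] is transitive because [H * P] is [G]. *)
have /atransP2 trP : [transitive P, on rcosets H G | 'Rs].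
  apply/(subgroup_transitiveP HX sPG (transRs_rcosets H G)).
  by rewrite astab1Rs (setIidPr sHG).
move=> i j; have [g Pg ij] := trP _ _ (enum_valP i) (enum_valP j).
by exists g => //; apply: enum_val_inj; rewrite phiE // (subsetP sPG).
Qed.

End TwistedRepresentation.

(** * Cyclic groups, p-groups and dihedral groups *)

Section SpecialGroups.

Local Open Scope ring_scope.

Variables (K : closedFieldType).

(** For [m] nonzero in [K], the polynomial X^m - 1 is separable and so has [m] distinct roots, one
    of which is primitive. *)
Lemma closed_prim_root m :
  [pchar K]^'.-nat m -> exists z : K, m.-primitive_root z.
Proof.
rewrite -natf_neq0_pchar => nz_m.
have m_gt0 : (0 < m)%N by rewrite lt0n; apply: contraNneq nz_m => ->.
have [r Dp] := closed_field_poly_normal ('X^m - 1 : {poly K}).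
rewrite (monicP _) ?monicXnsubC // scale1r in Dp.
have rm1: all m.-unity_root r by apply/allP=> z; rewrite -root_prod_XsubC -Dp.
have sz_r: (m < (size r).+1)%N by rewrite -(size_prod_XsubC r id) -Dp
  size_XnsubC.
have [|z] := hasP (has_prim_root m_gt0 rm1 _ sz_r); last by exists z.
by rewrite -separable_prod_XsubC -Dp separable_Xn_sub_1.
Qed.

(** Discrete logarithms are determined modulo the order of [x], hence modulo [m], so the powers of
    [z] are well defined. *)
Lemma cycle_linear_char (gT : finGroupType) (x : gT) m (z : K) :
    (m %| #[x]%g)%N -> m.-primitive_root z ->
  exists chi : gT -> K, forall i, chi (x ^+ i)%g = z ^+ i.
Proof.
move=> m_dvd prim_z.
pose log g := odflt ord0 [pick i : 'I_(#[x]%g).+1 | x ^+ i == g]%g.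
exists (fun g => z ^+ log g) => i; rewrite /log;
  case: pickP => [j /eqP xij|no_i].
  apply/eqP; rewrite (eq_prim_root_expr prim_z) -(modn_dvdm i m_dvd).
  by move/eqP: xij; rewrite eq_expg_mod_order => /eqP <-; rewrite modn_dvdm.
have lt_i : (i %% #[x]%g < (#[x]%g).+1)%N by rewrite ltnS ltnW ?ltn_pmod.
by have := no_i (Ordinal lt_i); rewrite /= expg_mod_order eqxx.
Qed.

(** Let [H] be the part of [G] of order prime to the characteristic and [P] its complement. A
    character of [G] of order [#|H|], twisting the [#|P|] cosets of [H], gives the bound
    [#|P| * #|H|]. *)
Lemma beta_sep_cyclic (gT : finGroupType) (G : {group gT}) :
  cyclic G -> beta_sep K G = Some #|G|.
Proof.
move=> cycG; apply: beta_sep_eq => [n rG|]; first exact: beta_sep_mod_le_card.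
have /dprodP[_ defG _ tiPH] :=
  nilpotent_pcoreC [pchar K] (abelian_nil (cyclic_abelian cycG)).
set P := 'O_[pchar K](G)%G in defG tiPH; set H :=
  'O_[pchar K]^'(G)%G in defG tiPH.
have [x defX] := cyclicP cycG; pose m := #|H|.
have sHG : H \subset G by apply: pcore_sub.
have m_dvd : (m %| #[x]%g)%N by rewrite orderE -defX cardSg.
have [z prim_z] := @closed_prim_root m (pcore_pgroup _ _).
have [chi chiE] := cycle_linear_char m_dvd prim_z.
have <- : (#|G : H|%g * m = #|G|)%N by rewrite mulnC Lagrange.
apply: (@induced_linear_beta _ _ _ _ P chi) => //.
- exact: pcore_sub.
- rewrite -[RHS]defG normC //; apply:
  subset_trans (normal_norm (pcore_normal _ _)).
  exact: pcore_sub.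
- exact: pcore_pgroup.
- move=> g h; rewrite defX => /cycleP[i ->] /cycleP[j ->].
  by rewrite -expgD !chiE exprD.
- move=> g; rewrite defX => /cycleP[i ->].
  by rewrite chiE -exprM mulnC exprM (prim_expr_order prim_z) expr1n.
- by exists x; rewrite ?defX ?cycle_id // -[x]expg1 chiE expr1.
Qed.

(** The regular representation, with trivial [H] and trivial twist, attains the bound. *)
Lemma beta_sep_pgroup p (gT : finGroupType) (G : {group gT}) :
  p \in [pchar K] -> (p.-group G)%g -> beta_sep K G = Some #|G|.
Proof.
move=> pK pG; apply: beta_sep_eq => [n rG|]; first exact: beta_sep_mod_le_card.
rewrite -[#|G|]muln1 -{1}indexg1.
apply: (@induced_linear_beta _ _ _ _ G (fun=> 1)) => //.
- exact: sub1G.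
- by rewrite mul1g.
- by rewrite /pgroup (eq_pnat _ (pcharf_eq pK)).
- by move=> g h _ _; rewrite mulr1.
- exists 1%g => //; apply/andP; split=> //; apply/forallP => i.
  by rewrite ord1 unity_rootE expr1n eqxx.
Qed.

(** The rotations [<[x]>] permute the [q] cosets of [<[y]>] transitively. The twist is the sign with
    kernel [<[x]>], of order 2 because 2 is nonzero in [K]. *)
Lemma beta_sep_dihedral q (gT : finGroupType) (G : {group gT}) :
    [pchar K].-nat q -> 2%:R != 0 :> K -> (1 < q)%N -> (G \isog 'D_(q.*2))%g ->
  beta_sep K G = Some q.*2.
Proof.
move=> q_p nz2 q_gt1 /(isoGrpP _ (Grp_dihedral q_gt1))[].
rewrite card_dihedral // => oG.
case/existsP=> -[x y] /=; rewrite !xpair_eqE =>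
  /and4P[/eqP defG /eqP xq /eqP y2 /eqP xy].
apply: beta_sep_eq => [n rG|]; first by rewrite -oG beta_sep_mod_le_card.
have {}defG : (<[x]> * <[y]> = G)%g.
  by rewrite -norm_joinEr // norms_cycle xy groupV cycle_id.
(* Otherwise [G] would be [<[x]>], of order at most [q]. *)
have x'y : y \notin <[x]>%g.
  apply: contraL (leqnn #|G|) => Xy; rewrite -ltnNge.
  rewrite -{1}defG mulGSid ?cycle_subG // oG -addnn.
  apply: leq_ltn_trans (_ : q < _)%N;
    last by rewrite -[X in (X < _)%N]addn0 ltn_add2l ltnW.
  by rewrite dvdn_leq 1?ltnW // order_dvdn xq.
have oy : #[y]%g = 2%N by apply: nt_prime_order (group1_contra x'y).
have tiXY : (<[x]> :&: <[y]> = 1)%g.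
  by rewrite setIC prime_TIg ?cycle_subG // -orderE oy.
have oX : #|<[x]>%g| = q.
  by apply: double_inj;
    rewrite -oG -defG TI_cardMg // -[#|<[y]>|%g]orderE oy muln2.
have sXG : <[x]>%g \subset G by rewrite -defG mulG_subl.
have sYG : <[y]>%g \subset G by rewrite -defG mulG_subr.
have yV : (y^-1 = y)%g by apply/eqP; rewrite eq_invg_mul -y2.
(* This makes the sign [chi] multiplicative. *)
have mul_xY g h : g \in G -> h \in G -> g \notin <[x]>%g -> h \notin <[x]>%g ->
    (g * h)%g \in <[x]>%g.
  rewrite -defG => /mulsgP[a b Xa + ->] /mulsgP[c d Xc + ->].
  rewrite (cycle2g oy) !inE.
  have nX : y \in 'N(<[x]>)%g.
    by rewrite -cycle_subG norms_cycle xy groupV cycle_id.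
  move=> /orP[]/eqP-> /orP[]/eqP->; rewrite ?mulg1 ?Xa ?Xc // => _ _.
  have -> : (a * y * (c * y) = a * c ^ y)%g.
    by rewrite conjgE yV !mulgA.
  by rewrite groupM // memJ_norm.
have <- : (#|G : <[y]>|%g * 2)%N = q.*2 by rewrite -oy mulnC Lagrange.
have neqN1 : -1 != 1 :> K.
  by apply: contraNneq nz2 => N1; rewrite mulr2n -{1}N1 addNr.
pose chi g : K := (-1) ^+ (g \notin <[x]>%g).
apply: (@induced_linear_beta _ _ _ _ <[x]>%G chi) => //.
- by rewrite /= -defG [LHS]normC // norms_cycle xy groupV cycle_id.
- by rewrite /pgroup /= oX.
- move=> g h Gg Gh; rewrite /chi -signr_addb; congr (_ ^+ nat_of_bool _).
  have [Xg|X'g] := boolP (g \in <[x]>%g); first by rewrite groupMl.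
  have [Xh|X'h] := boolP (h \in <[x]>%g); first by rewrite groupMr ?(negPf X'g).
  by rewrite mul_xY.
- by move=> g _; rewrite sqrr_sign.
- exists y; first by rewrite -cycle_subG.
  rewrite /chi x'y /=; apply/andP; split=> //; apply/forallP => i.
  rewrite unity_rootE; case: i => [[|[|//]] lt_i] /=.
    by rewrite !expr1 (negPf neqN1).
  by rewrite sqrr_sign !eqxx.
Qed.

End SpecialGroups.

(** * Recovering orbits from products of at most four coordinates *)

Section QuarticInvariants.

Local Open Scope ring_scope.

Variable K : fieldType.

(** Each [s' j] is a root of (X - s_j)(X - t_j). At an index [i0] where [s] and [t] differ, the root
    taken decides between the alternatives, and the cross terms carry this choice to every [j]. *)
Lemma swap_dichotomy (J : Type) (s t s' t' : J -> K) :
    (forall j, s j + t j = s' j + t' j) ->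
    (forall j, s j * t j = s' j * t' j) ->
    (forall i j, s i * t j + t i * s j = s' i * t' j + t' i * s' j) ->
  (s' =1 s /\ t' =1 t) \/ (s' =1 t /\ t' =1 s).
Proof.
move=> add_st mul_st cross_st.
have t'E j : t' j = s j + t j - s' j by rewrite add_st addrAC subrr add0r.
have root_s' j : (s' j - s j) * (s' j - t j) = 0.
  have := mul_st j; rewrite t'E => st.
  have -> : (s' j - s j) * (s' j - t j) = s j * t j - s' j * (s j + t j - s' j)
    by ring.
  by rewrite -st subrr.
have [[i0 st0]|eq_st] := pselect (exists i, s i <> t i); last first.
  have {}eq_st j : t j = s j by apply/esym; apply: contrapT => ?; apply: eq_st;
    exists j.
  left; have s'E : s' =1 s.
    by move=> j; apply/eqP; have /eqP := root_s' j;
      rewrite eq_st mulf_eq0 orbb subr_eq0.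
  by split=> // j; rewrite t'E s'E addrAC subrr add0r.
have nz0 : t i0 - s i0 != 0 by rewrite subr_eq0 eq_sym; apply/eqP.
have /eqP := root_s' i0; rewrite mulf_eq0 !subr_eq0 => /orP[]/eqP s'0;
  [left|right].
  have s'E : s' =1 s.
    move=> j; apply/eqP; rewrite -subr_eq0 -(mulrI_eq0 _ (mulfI nz0));
      apply/eqP.
    have := cross_st i0 j; rewrite !t'E s'0 => e.
    transitivity ((s i0 * (s j + t j - s' j) + (s i0 + t i0 - s i0) * s' j) -
      (s i0 * t j + t i0 * s j)); first by ring.
    by rewrite -e subrr.
  by split=> // j; rewrite t'E s'E addrAC subrr add0r.
have s'E : s' =1 t.
  move=> j; apply/eqP; rewrite -subr_eq0 -(mulrI_eq0 _ (mulfI nz0)); apply/eqP.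
  have := cross_st i0 j; rewrite !t'E s'0 => e.
  transitivity ((s i0 * t j + t i0 * s j) - (t i0 * (s j + t j - s' j) + (s i0
    + t i0 - t i0) * s' j)); first by ring.
  by rewrite -e subrr.
by split=> // j; rewrite t'E s'E addrK.
Qed.

(** The ratio at an index where [a] is nonzero serves everywhere: cancel the square of that
    coordinate. *)
Lemma cube_ratio (I : Type) (a a' : I -> K) :
    (forall i j k, a i * a j * a k = a' i * a' j * a' k) ->
  exists2 z, z ^+ 3 = 1 & forall i, a' i = z * a i.
Proof.
move=> aaa; have [[i0 /eqP ai0]|a0] := pselect (exists i, a i <> 0); last first.
  exists 1 => [|i]; first exact: expr1n.
  have ai : a i = 0 by apply: contrapT => ?; apply: a0; exists i.
  have /esym/eqP := aaa i i i; rewrite ai !mulr0 !mulf_eq0 !orbb => /eqP->.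
  by [].
have z3 : (a' i0 / a i0) ^+ 3 = 1.
  by rewrite expr_div_n !exprS expr0 !mulr1 !mulrA -aaa divff // !mulf_neq0.
exists (a' i0 / a i0) => // i; set z := _ / _ in z3 *.
have a'i0 : a' i0 = z * a i0 by rewrite divfK.
apply: (mulfI (x := z ^+ 2 * a i0 ^+ 2)).
  rewrite mulf_neq0 ?expf_neq0 //; apply: contra_eq_neq z3 => ->.
  by rewrite expr0n eq_sym oner_neq0.
transitivity (a' i0 * a' i0 * a' i); first by rewrite a'i0; ring.
rewrite -aaa; transitivity (z ^+ 3 * (a i0 * a i0 * a i)); last by ring.
by rewrite z3 mul1r.
Qed.

(** If [a] is nonzero, its cubes give [z], and the products with [b] then determine [b']. Otherwise
    [a] and [a'] vanish and the cubes of [b] give [z]. *)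
Lemma C3_dichotomy (I : Type) (a b a' b' : I -> K) :
    (forall i j, a i * b j = a' i * b' j) ->
    (forall i j k, a i * a j * a k = a' i * a' j * a' k) ->
    (forall i j k, b i * b j * b k = b' i * b' j * b' k) ->
  exists2 z, z ^+ 3 = 1 & forall i, a' i = z * a i /\ b' i = z ^+ 2 * b i.
Proof.
move=> ab aaa bbb; have [[i0 /eqP ai0]|a0] := pselect (exists i, a i <> 0).
  have [z z3 a'E] := cube_ratio aaa; exists z => // i; split=> //.
  apply: (mulfI ai0); rewrite mulrCA ab a'E.
  by rewrite !mulrA -exprSr z3 mul1r.
have [z z3 b'E] := cube_ratio bbb; exists (z ^+ 2) => [|i].
  by rewrite exprAC z3 expr1n.
have ai : a i = 0 by apply: contrapT => ?; apply: a0; exists i.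
split; last by rewrite b'E -exprM (exprD _ 3 1) z3 mul1r.
have /esym/eqP := aaa i i i; rewrite ai !mulr0 !mulf_eq0 !orbb => /eqP->.
by [].
Qed.

(** If some [a i * b j] is nonzero, then [a'] is [s] times [a] and [b] is [s] times [b'] for one
    scalar [s]. Otherwise one of [a], [b] and one of [a'], [b'] vanish, and cubes compare what is
    left. *)
Lemma S3_dichotomy (I : Type) (a b a' b' : I -> K) :
    (forall i j, a i * b j = a' i * b' j) ->
    (forall i j k, a i * a j * a k + b i * b j * b k =
       a' i * a' j * a' k + b' i * b' j * b' k) ->
  exists2 z, z ^+ 3 = 1 &
    (forall i, a' i = z * a i /\ b' i = z ^+ 2 * b i) \/
    (forall i, a' i = z * b i /\ b' i = z ^+ 2 * a i).
Proof.
move=> ab aaabbb.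
have z2 z : z ^+ 3 = 1 -> (z ^+ 2) ^+ 3 = 1 /\ (z ^+ 2) ^+ 2 = z :> K.
  by move=> z3; rewrite exprAC z3 expr1n -exprM (exprD _ 3 1) z3 mul1r.
have is0 (c : I -> K) : ~ (exists i, c i <> 0) -> forall i, c i = 0.
  by move=> c0 i; apply: contrapT => ci; apply: c0; exists i.
have zero_or (c d : I -> K) : (forall i j, c i * d j = 0) ->
    (forall i, c i = 0) \/ (forall i, d i = 0).
  move=> cd; have [[i0 /eqP ci0]|/is0] := pselect (exists i, c i <> 0);
    last by left.
  by right=> j; apply: (mulfI ci0); rewrite cd mulr0.
have [[[i0 j0] /= /eqP abij]|ab0] := pselect (exists ij : I * I,
  a ij.1 * b ij.2 <> 0).
  have /andP[ai0 bj0] :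
    (a i0 != 0) && (b j0 != 0) by rewrite -negb_or -mulf_eq0.
  have /andP[a'i0 b'j0] : (a' i0 != 0) && (b' j0 != 0).
    by rewrite -negb_or -mulf_eq0 -ab.
  pose s := b j0 / b' j0; have nz_s : s != 0 by rewrite mulf_neq0 ?invr_eq0.
  have a'E i : a' i = s * a i.
    by apply: (mulIf b'j0); rewrite -ab mulrAC divfK // mulrC.
  have bE i : b i = s * b' i.
    by apply: (mulfI ai0); rewrite ab a'E; ring.
  (* The cubic relation now reads (s^3 - 1)(a_i a_j a_k - b'_i b'_j b'_k) = 0: either [s] is a
     rotation, or [b'] is a multiple of [a] and the points differ by a reflection. *)
  have [s3|s3] := eqVneq (s ^+ 3) 1.
    exists s => //; left=> i; split; first exact: a'E.
    by rewrite bE mulrA -exprSr s3 mul1r.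
  have [i j k|z z3 b'E] := @cube_ratio I a b'.
    apply: (mulfI (x := s ^+ 3 - 1)); first by rewrite subr_eq0.
    have := aaabbb i j k; rewrite !a'E !bE => e.
    apply/eqP; rewrite -subr_eq0; apply/eqP.
    set u := (X in X = _) in e; set v := (X in _ = X) in e.
    by transitivity (v - u); [rewrite /u /v; ring | rewrite e subrr].
  have [z23 z22] := z2 z z3; exists (z ^+ 2) => //; right=> i.
  rewrite z22; split; last exact: b'E.
  rewrite bE b'E a'E; transitivity (z ^+ 3 * (s * a i)); last by ring.
  by rewrite z3 mul1r.
have {}ab0 i j : a i * b j = 0 by apply: contrapT => ?; apply: ab0;
  exists (i, j).
have a'b'0 i j : a' i * b' j = 0 by rewrite -ab.
have [a0|b0] := zero_or _ _ ab0; have [a'0|b'0] := zero_or _ _ a'b'0.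
- have [i j k|i j k|z z3 zE] := @C3_dichotomy I a b a' b' ab;
  last by exists z => //; left.
    by rewrite !a0 !a'0.
  by have := aaabbb i j k; rewrite !a0 !a'0 !mulr0 !add0r.
- have [i j k|z z3 a'E] := @cube_ratio I b a'.
    by have := aaabbb i j k; rewrite !a0 !b'0 !mulr0 add0r addr0.
  by exists z => //; right=> i; rewrite a'E b'0 a0 mulr0.
- have [i j k|z z3 b'E] := @cube_ratio I a b'.
    by have := aaabbb i j k; rewrite !b0 !a'0 !mulr0 add0r addr0.
  have [z23 z22] := z2 z z3.
  by exists (z ^+ 2) => //; right=> i; rewrite b'E a'0 b0 mulr0 z22.
have [i j k|i j k|z z3 zE] := @C3_dichotomy I a b a' b' ab;
  last by exists z => //; left.
  by have := aaabbb i j k; rewrite !b0 !b'0 !mulr0 !addr0.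
by rewrite !b0 !b'0 !mulr0.
Qed.

(* u and a are the coordinates of a point of V in the fixed space and in one
   eigenspace of the 3-cycle, and v and b those of its image under the
   involution; the second point has the same u and v. *)
Lemma S3_orbit_fixed_u (I : Type) (u v a b a' b' : I -> K) :
    (forall i j, a i * b j + a j * b i = a' i * b' j + a' j * b' i) ->
    (forall i, a i * b i = a' i * b' i) ->
    (forall l i j, u l * (a i * b j) + v l * (a j * b i) =
       u l * (a' i * b' j) + v l * (a' j * b' i)) ->
    (forall i j k l, (a i * b j) * (a l * b k) + (a j * b i) * (a k * b l) =
       (a' i * b' j) * (a' l * b' k) + (a' j * b' i) * (a' k * b' l)) ->
    (forall i j k, a i * a j * a k + b i * b j * b k =
       a' i * a' j * a' k + b' i * b' j * b' k) ->
    (forall l i j k, u l * (a i * a j * a k) + v l * (b i * b j * b k) =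
       u l * (a' i * a' j * a' k) + v l * (b' i * b' j * b' k)) ->
  exists2 z, z ^+ 3 = 1 &
    (forall i, a' i = z * a i /\ b' i = z ^+ 2 * b i) \/
    u =1 v /\ (forall i, a' i = z * b i /\ b' i = z ^+ 2 * a i).
Proof.
move=> abD ab uabD abX aaabbb uaaabbb.
have [[l /eqP]|uv] := pselect (exists l, u l <> v l).
  rewrite -subr_eq0 => uvl.
  (* With [u l] and [v l] different, a sum and its weighted sum determine both summands, so the
     invariants of the 3-cycle agree separately. *)
  have split_sum (s t s' t' : K) : s + t = s' + t' ->
      u l * s + v l * t = u l * s' + v l * t' -> s = s' /\ t = t'.
    move=> e1 e2; suff es : s = s' by split=> //; apply: (addrI s);
      rewrite e1 es.
    apply: (mulfI uvl); transitivity (u l * s + v l * t - v l * (s + t));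
      first by ring.
    by rewrite e1 e2; ring.
  have [|||z z3 zE] := @C3_dichotomy I a b a' b'; last by exists z => //; left.
  - by move=> i j; have [] := split_sum _ _ _ _ (abD i j) (uabD l i j).
  - by move=> i j k; have [] :=
    split_sum _ _ _ _ (aaabbb i j k) (uaaabbb l i j k).
  - by move=> i j k; have [] :=
    split_sum _ _ _ _ (aaabbb i j k) (uaaabbb l i j k).
have {}uv : u =1 v by move=> l; apply: contrapT => ?; apply: uv; exists l.
(* For [u = v], the quartic relations fix the pairs (a_i b_j, a_j b_i) up to one simultaneous swap;
   a swap amounts to exchanging [a'] and [b']. *)
pose T (c d : I -> K) (ij : I * I) := c ij.1 * d ij.2.
pose T' (c d : I -> K) (ij : I * I) := c ij.2 * d ij.1.
have [||||] := @swap_dichotomy (I * I)%type (T a b) (T' a b)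
  (T a' b') (T' a' b').
- by case=> i j; apply: abD.
- move=> [i j]; rewrite /T /T' /=; transitivity ((a i * b i) * (a j * b j));
  first by ring.
  by rewrite !ab; ring.
- by move=> [i j] [k l]; apply: abX.
- move=> [eT _]; have [i j|z z3 [zE|zE]] := @S3_dichotomy I a b a' b' _ aaabbb.
  - by have := eT (i, j).
  - by exists z => //; left.
  - by exists z => //; right.
move=> [eT _]; have [i j|i j k|z z3 zE] := @S3_dichotomy I a b b' a'.
- by have := eT (j, i); rewrite /T /T' /= mulrC => <-; rewrite mulrC.
- by rewrite [RHS]addrC.
- exists (z ^+ 2); first by rewrite exprAC z3 expr1n.
  have z22 : (z ^+ 2) ^+ 2 = z by rewrite -exprM (exprD _ 3 1) z3 mul1r.
  by rewrite z22; case: zE => zE; [right; split=> // i | left=> i];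
    have [] := zE i.
Qed.

End QuarticInvariants.

(** * Upper bound for S_3 in characteristic 2 *)

Section SymmetricGroup3.

Local Open Scope ring_scope.

(** With ['I_3] read as Z/3, S_3 is the affine group, and its relations become arithmetic modulo
    3. *)
Definition rho3 : 'S_3 := perm (addIr (1 : 'I_3)).
Definition sigma3 : 'S_3 := perm (@oppr_inj 'I_3).

Lemma sigma3_rho3 : (sigma3 * rho3 = rho3 * rho3 * sigma3)%g.
Proof.
apply/permP => i; rewrite !permM !permE opprD opprD -!addrA; congr (_ + _).
exact/val_inj.
Qed.

Lemma rho3_sigma3 : (rho3 * sigma3 = sigma3 * (rho3 * rho3))%g.
Proof.
apply/permP => i; rewrite !permM !permE opprD -!addrA; congr (_ + _).
exact/val_inj.
Qed.

Lemma rho3_order : #[rho3]%g = 3%N.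
Proof.
apply: nt_prime_order => //; last first.
  by apply/eqP => /permP/(_ ord0)/eqP; rewrite permE perm1 -val_eqE.
apply/permP => i; rewrite !expgS expg0 mulg1 perm1 !permM !permE -!addrA
  -[RHS]addr0.
by congr (_ + _); apply/val_inj.
Qed.

Lemma sigma3_order : #[sigma3]%g = 2%N.
Proof.
apply: nt_prime_order => //; last first.
  by apply/eqP => /permP/(_ (1 : 'I_3))/eqP; rewrite permE perm1 -val_eqE.
by apply/permP => i; rewrite !expgS expg0 mulg1 perm1 !permM !permE opprK.
Qed.

Lemma S3_elements (g : 'S_3) :
  exists k, (g = rho3 ^+ k)%g \/ (g = rho3 ^+ k * sigma3)%g.
Proof.
have /mulsgP[r s /cycleP[k ->]]: g \in (<[rho3]> * <[sigma3]>)%g.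
  suff -> : (<[rho3]> * <[sigma3]> = [set: 'S_3])%g by rewrite inE.
  apply/eqP; rewrite eqEcard subsetT coprime_cardMg -?orderE ?rho3_order
    ?sigma3_order //.
  by rewrite cardsT card_Sn.
rewrite (cycle2g sigma3_order) !inE => /orP[]/eqP -> ->; exists k;
  last by right.
by left; rewrite mulg1.
Qed.

Variables (K : closedFieldType) (w : K).
Hypotheses (K2 : 2%N \in [pchar K]) (prim_w : 3.-primitive_root w).

Let w3 : w ^+ 3 = 1. Proof. exact: prim_expr_order. Qed.

Lemma prim3_sum : 1 + w + w ^+ 2 = 0.
Proof.
have w1 : w - 1 != 0.
  by rewrite subr_eq0 -[w]expr1 -(prim_order_dvd prim_w).
apply: (mulfI w1); rewrite mulr0; transitivity (w ^+ 3 - 1); first by ring.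
by rewrite w3 subrr.
Qed.

Lemma beta_sep_mod_S3_le n (rG : mx_representation K [set: 'S_3]%G n) :
  (beta_sep_mod rG <= 4)%N.
Proof.
pose R := rG rho3; pose S := rG sigma3.
have repM g h : rG (g * h)%g = rG g *m rG h by rewrite repr_mxM ?inE.
have S2 : S *m S = 1%:M.
  have s2 : (sigma3 ^+ 2 = 1)%g by apply/eqP; rewrite -order_dvdn sigma3_order.
  by rewrite -repM -[(_ * _)%g]/(sigma3 ^+ 2)%g s2 repr_mx1.
have R3 : R *m (R *m R) = 1%:M.
  have r3 : (rho3 ^+ 3 = 1)%g by apply/eqP; rewrite -order_dvdn rho3_order.
  by rewrite -!repM -[(_ * (_ * _))%g]/(rho3 ^+ 3)%g r3 repr_mx1.
have SR : S *m R = R *m R *m S by rewrite -!repM sigma3_rho3.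
have RS : R *m S = S *m (R *m R) by rewrite -!repM rho3_sigma3.
(* As 3 = 1 in [K], the matrices [E0], [E1] and [S *m E1 *m S] are the projections onto the
   eigenspaces of [R] for 1, [w] and [w ^+ 2], with no factor 1/3. *)
pose E0 := 1%:M + R + R *m R.
pose E1 := 1%:M + w ^+ 2 *: R + w *: (R *m R).
have RE0 : R *m E0 = E0.
  by rewrite /E0 !mulmxDr mulmx1 R3 [LHS]addrC addrA.
have RE1 : R *m E1 = w *: E1.
  rewrite /E1 !mulmxDr mulmx1 -!scalemxAr R3 !scalerDr !scalerA -exprS w3
    scale1r.
  by rewrite -expr2 [LHS]addrC addrA.
have E1E : E0 + E1 + S *m E1 *m S = 1%:M.
  have -> : S *m E1 *m S = 1%:M + w ^+ 2 *: (R *m R) + w *: R.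
    rewrite /E1 !mulmxDr mulmx1 !mulmxDl S2 -!scalemxAr -!scalemxAl;
      congr (_ + _ *: _ + _ *: _).
      by rewrite SR -mulmxA S2 mulmx1.
    by rewrite -RS -mulmxA S2 mulmx1.
  rewrite /E0 /E1; move: (R *m R) => Q; apply/matrixP => i j; rewrite !mxE.
  set d := _%:R; transitivity (d + (d + d) + (1 + w + w ^+ 2) * (R i j + Q i
    j)); first by ring.
  by rewrite prim3_sum mul0r addr0 (addrr_pchar2 K2) addr0.
(* [S] exchanges [u] with [v] and [a] with [b]; [R] fixes [u] and [v] and scales [a] by [w] and [b]
   by [w ^+ 2]. *)
pose u i (x : 'rV[K]_n) := (x *m E0) 0 i; pose v i (x : 'rV[K]_n) :=
  (x *m S *m E0) 0 i.
pose a i (x : 'rV[K]_n) := (x *m E1) 0 i; pose b i (x : 'rV[K]_n) :=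
  (x *m S *m E1) 0 i.
have uR i x : u i (x *m R) = u i x by rewrite /u -mulmxA RE0.
have vR i x : v i (x *m R) = v i x.
  by rewrite /v -(mulmxA x) RS -!mulmxA RE0 RE0.
have aR i x : a i (x *m R) = w * a i x by rewrite /a -mulmxA RE1 -scalemxAr mxE.
have bR i x : b i (x *m R) = w ^+ 2 * b i x.
  by rewrite /b -(mulmxA x) RS -!mulmxA RE1 -!scalemxAr RE1 -!scalemxAr scalerA
    mxE.
have vS i x : v i (x *m S) = u i x by rewrite /v -(mulmxA x) S2 mulmx1.
have bS i x : b i (x *m S) = a i x by rewrite /b -(mulmxA x) S2 mulmx1.
have uS i x : u i (x *m S) = v i x by [].
have aS i x : a i (x *m S) = b i x by [].
have coord_inj x y : (forall i, u i x = u i y) -> (forall i, a i x = a i y) ->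
    (forall i, b i x = b i y) -> x = y.
  have xE (z : 'rV_n) : z = z *m E0 + z *m E1 + z *m S *m E1 *m S.
    by rewrite -[LHS]mulmx1 -E1E 2!mulmxDr !mulmxA.
  move=> uxy axy bxy; rewrite [x]xE [y]xE.
  by congr (_ + _ + _ *m S); apply/rowP => i;
    [apply: uxy | apply: axy | apply: bxy].
(* The powers of [w] cancel in these products; adding the image under [S] makes them invariant under
   the whole group. *)
pose T i j x := a i x * b j x.
pose C i j k x := a i x * a j x * a k x.
pose D i j k x := b i x * b j x * b k x.
have TR i j x : T i j (x *m R) = T i j x.
  rewrite /T aR bR; transitivity (w ^+ 3 * (a i x * b j x)); first by ring.
  by rewrite w3 mul1r.
have CR i j k x : C i j k (x *m R) = C i j k x.
  rewrite /C !aR; transitivity (w ^+ 3 * (a i x * a j x * a k x));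
    first by ring.
  by rewrite w3 mul1r.
have DR i j k x : D i j k (x *m R) = D i j k x.
  rewrite /D !bR; transitivity ((w ^+ 3) ^+ 2 * (b i x * b j x * b k x));
    first by ring.
  by rewrite w3 expr1n mul1r.
have TS i j x : T i j (x *m S) = T j i x by rewrite /T bS mulrC.
have CS i j k x : C i j k (x *m S) = D i j k x by [].
have DS i j k x : D i j k (x *m S) = C i j k x by rewrite /D !bS.
have du i : poly_fun 1 (u i) by apply: poly_fun_linear.
have dv i : poly_fun 1 (v i).
  have [f sf Ef] := poly_fun_linear (S *m E0) i.
  by exists f => // x; rewrite Ef /v mulmxA.
have da i : poly_fun 1 (a i) by apply: poly_fun_linear.
have db i : poly_fun 1 (b i).
  have [f sf Ef] := poly_fun_linear (S *m E1) i.
  by exists f => // x; rewrite Ef /b mulmxA.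
have dT i j : poly_fun 2 (T i j) by apply: poly_funM (da i) (db j).
have dC i j k : poly_fun 3 (C i j k).
  exact: poly_funM (poly_funM (da i) (da j)) (da k).
have dD i j k : poly_fun 3 (D i j k).
  exact: poly_funM (poly_funM (db i) (db j)) (db k).
have repRk (F : 'rV_n -> K) c : (forall z, F (z *m R) = c * F z) ->
    forall k z, F (z *m rG (rho3 ^+ k)%g) = c ^+ k * F z.
  move=> FR; elim=> [|k IHk] z; first by rewrite expg0 repr_mx1 mulmx1 mul1r.
  by rewrite expgSr repM mulmxA FR IHk mulrA -exprS.
have repRk1 (F : 'rV_n -> K) : (forall z, F (z *m R) = F z) ->
    forall k z, F (z *m rG (rho3 ^+ k)%g) = F z.
  move=> FR k z; rewrite (@repRk _ 1) ?expr1n ?mul1r // => z1.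
  by rewrite mul1r FR.
pose agree (x y : 'rV_n) := forall d F, (d <= 4)%N -> poly_fun d F ->
  (forall z, F (z *m R) = F z) -> (forall z, F (z *m S) = F z) -> F x = F y.
have orbit_eq_u x y : (forall i, u i y = u i x) -> (forall i, v i y = v i x) ->
    agree x y -> exists g, y = x *m rG g.
  move=> uE vE eqF.
  have [||||||z z3 zE] :=
    @S3_orbit_fixed_u K 'I_n (u^~ x) (v^~ x) (a^~ x) (b^~ x) (a^~ y) (b^~ y).
  - move=> i j; apply: (eqF 2 (fun z => T i j z + T j i z)) => // [|z|z].
    + exact: poly_funD.
    + by rewrite !TR.
    + by rewrite !TS addrC.
  - by move=> i; apply: (eqF 2 (T i i)).
  - move=> l i j; rewrite -{2}uE -{2}vE.
    apply: (eqF 3 (fun z => u l z * T i j z + v l z * T j i z)) => // [|z|z].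
    + exact: poly_funD (poly_funM (du l) (dT i j)) (poly_funM (dv l) (dT j i)).
    + by rewrite !TR uR vR.
    + by rewrite !TS uS vS addrC.
  - move=> i j k l; apply: (eqF 4 (fun z =>
    T i j z * T l k z + T j i z * T k l z)) => // [|z|z].
    + exact: poly_funD (poly_funM (dT i j) (dT l k))
                       (poly_funM (dT j i) (dT k l)).
    + by rewrite !TR.
    + by rewrite !TS addrC.
  - move=> i j k; apply: (eqF 3 (fun z => C i j k z + D i j k z)) => // [|z|z].
    + exact: poly_funD.
    + by rewrite CR DR.
    + by rewrite CS DS addrC.
  - move=> l i j k; rewrite -{2}uE -{2}vE.
    apply: (eqF 4 (fun z => u l z * C i j k z + v l z * D i j k z)) =>
      // [|z|z].
    + exact: poly_funD (poly_funM (du l) (dC i j k))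
                       (poly_funM (dv l) (dD i j k)).
    + by rewrite CR DR uR vR.
    + by rewrite CS DS uS vS addrC.
  have [k {z3}zk] := prim_rootP prim_w z3; rewrite {}zk in zE.
  case: zE => [abE|[uv abE]];
    [exists (rho3 ^+ k)%g | exists (sigma3 * rho3 ^+ k)%g].
    apply: coord_inj => i.
    - by rewrite (repRk1 (u i)).
    - by rewrite (repRk (a i) w) //; have [] := abE i.
    - by rewrite (repRk (b i) (w ^+ 2)) //; have [_] := abE i; rewrite exprAC.
  rewrite repM mulmxA; apply: coord_inj => i.
  - by rewrite (repRk1 (u i)) // uE uS; apply: uv.
  - by rewrite (repRk (a i) w) //; have [] := abE i.
  - by rewrite (repRk (b i) (w ^+ 2)) // bS; have [_] := abE i; rewrite exprAC.
apply: beta_sep_mod_le => x x' eqF.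
have {}eqF : agree x x'.
  move=> d F d4 [f sf Ef] FR FS; apply: eqF => [|g y _].
    by exists f => //; apply: leq_trans sf _.
  by have [k [->|->]] := S3_elements g; rewrite ?repM ?mulmxA ?FS repRk1.
suff [g ->] : exists g, x' = x *m rG g by exists g; rewrite ?inE.
(* Symmetric expressions in [u] and [v] determine them up to a swap; in the swapped case [x' *m S]
   replaces [x']. *)
have [|||[uE vE]|[uE vE]] :=
  @swap_dichotomy K 'I_n (u^~ x) (v^~ x) (u^~ x') (v^~ x').
- move=> i; apply: (eqF 1 (fun z => u i z + v i z)) => // [|z|z].
  + exact: poly_funD.
  + by rewrite uR vR.
  + by rewrite vS uS addrC.
- move=> i; apply: (eqF 2 (fun z => u i z * v i z)) => // [|z|z].
  + exact: poly_funM (du i) (dv i).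
  + by rewrite uR vR.
  + by rewrite vS uS mulrC.
- move=> i j; apply: (eqF 2 (fun z => u i z * v j z + v i z * u j z)) =>
  // [|z|z].
  + exact: poly_funD (poly_funM (du i) (dv j)) (poly_funM (dv i) (du j)).
  + by rewrite !uR !vR.
  + by rewrite !vS !uS addrC.
- exact: orbit_eq_u.
have [|i|d F d4 dF FR FS|g gE] := @orbit_eq_u x (x' *m S).
- by move=> i; rewrite uS; apply: vE.
- by rewrite vS; apply: uE.
- by rewrite FS; apply: eqF dF FR FS.
exists (g * sigma3)%g.
by rewrite repM mulmxA -gE -mulmxA S2 mulmx1.
Qed.

End SymmetricGroup3.

(** * Lower bound for S_3 in characteristic 2 *)

Section LowerBoundS3.

Local Open Scope ring_scope.

Variables (K : closedFieldType) (w : K).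
Hypotheses (K2 : 2%N \in [pchar K]) (prim_w : 3.-primitive_root w).

Let w3 : w ^+ 3 = 1. Proof. exact: prim_expr_order. Qed.

(** The linear and quadratic terms sum to 0 over the cube roots of unity, and the constant term is
    counted 3 = 1 times. *)
Lemma sum_prim3_quadratic (p : {poly K}) :
  (size p <= 3)%N -> \sum_(k < 3) p.[w ^+ k] = p.[0].
Proof.
move=> sp; have pE t : p.[t] = p`_0 + p`_1 * t + p`_2 * t ^+ 2.
  by rewrite (horner_coef_wide _ sp) !big_ord_recl big_ord0 /= addr0 mulr1
    expr1 addrA.
have w0 := prim3_sum prim_w.
rewrite !big_ord_recl big_ord0 /= !pE.
transitivity (p`_0 * (1 + (1 + 1)) + p`_1 * (1 + w + w ^+ 2) + p`_2 * (1 + w ^+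
  2 + w ^+ 3 * w)).
  by rewrite /bump /=; ring.
have w0' : 1 + w ^+ 2 + w = 0 by rewrite addrAC.
by rewrite w3 mul1r w0 w0' (addrr_pchar2 K2); ring.
Qed.

Lemma size_affine_prod_sub n (c al : 'I_n -> K) (m : 'I_n -> nat) :
  (size (\prod_i ((c i)%:P + al i *: 'X) ^+ m i -
         \prod_i (al i *: 'X) ^+ m i : {poly K})%R <= \sum_i m i)%N.
Proof.
(* Degree at most [d] and equal coefficients in degree [d]: a condition stable under products. *)
pose close (A B : {poly K}) d :=
  [/\ (size A <= d.+1)%N, (size B <= d.+1)%N & (size (A - B)%R <= d)%N].
have close1 : close 1 1 0%N by rewrite /close size_poly1 subrr size_poly0.
have closeM A B d A' B' d' :
    close A B d -> close A' B' d' -> close (A * A') (B * B') (d + d')%N.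
  have sizeM (P Q : {poly K}) a b : (size P <= a.+1)%N -> (size Q <= b)%N ->
    (size (P * Q)%R <= a + b)%N.
    move=> sP sQ; apply: leq_trans (size_polyMleq _ _) _.
    by have := leq_add sP sQ; case: (_ + _)%N.
  move=> [sA sB sAB] [sA' sB' sAB']; split; rewrite -?addnS ?sizeM //.
  have -> : A * A' - B * B' = A * (A' - B') + B' * (A - B) by ring.
  apply: leq_trans (size_polyD _ _) _.
  by rewrite geq_max sizeM //= addnC sizeM.
suff [] : close (\prod_i ((c i)%:P + al i *: 'X) ^+ m i)
                (\prod_i (al i *: 'X) ^+ m i) (\sum_i m i)%N by [].
apply: (big_ind3 close) => // i _.
elim: (m i) => [|k IHk]; first by rewrite !expr0.
rewrite !exprS -add1n; apply: closeM IHk; split.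
- apply: leq_trans (size_polyD _ _) _;
  rewrite geq_max (leq_trans (size_polyC_leq1 _)) //.
  by apply: leq_trans (size_scale_leq _ _) _; rewrite size_polyX.
- by apply: leq_trans (size_scale_leq _ _) _; rewrite size_polyX.
- by rewrite addrK size_polyC_leq1.
Qed.

Lemma sum_prim3_cubic n (f : {mpoly K[n]}) (c al : 'rV[K]_n) :
    (msize f <= 4)%N ->
  \sum_(k < 3) (mpeval f (c + w ^+ k *: al) - mpeval f (w ^+ k *: al)) =
  mpeval f c - mpeval f 0.
Proof.
move=> sf.
pose q (m : 'X_{1..n}) :=
  \prod_i ((c 0 i)%:P + al 0 i *: 'X) ^+ m i -
  \prod_i (al 0 i *: 'X) ^+ m i : {poly K}.
pose p := \sum_(m <- msupp f) f@_m *: q m.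
have pE t : p.[t] = mpeval f (c + t *: al) - mpeval f (t *: al).
  rewrite /mpeval !mevalE horner_sum -sumrB; apply: eq_bigr => m _.
  rewrite hornerZ hornerD hornerN !horner_prod mulrBr.
  congr (_ * _ - _ * _); apply: eq_bigr => i _;
    rewrite horner_exp !hornerE !mxE.
    by rewrite [t * _]mulrC.
  by rewrite [t * _]mulrC.
have sp : (size p <= 3)%N.
  rewrite /p big_seq; apply: leq_trans (size_sum _ _ _) _.
  apply/bigmax_leqP_seq => m fm _; apply: leq_trans (size_scale_leq _ _) _.
  apply: leq_trans (size_affine_prod_sub _ _ _) _.
  by rewrite -mdegE -ltnS; apply: leq_trans sf; apply: msize_mdeg_lt.
have := sum_prim3_quadratic sp; rewrite pE scale0r addr0 => <-.
by apply: eq_bigr => k _; rewrite pE.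
Qed.

Lemma prim3_expD (i j : 'I_3) : w ^+ (i + j)%R = w ^+ i * w ^+ j.
Proof. by rewrite -exprD -(expr_mod (i + j) w3). Qed.

(** All three terms of the sum over cube roots of unity coincide, and 3 = 1. Leaving [g] free allows
    eigenvectors of both [rho3] and its inverse. *)
Lemma cubic_invariants_collapse n (rG : mx_representation K [set: 'S_3]%G n)
    c d f g :
    invariant_le rG 3 f -> c *m rG g = c -> d *m rG g = w *: d ->
  mpeval f (c + d) = mpeval f c - mpeval f 0 + mpeval f d.
Proof.
move=> [fG sf] cg dg.
have fE (x : 'rV_n) : mpeval f (x *m rG g) = mpeval f x by rewrite fG ?inE.
have fcd k : mpeval f (c + w ^+ k *: d) = mpeval f (c + d).
  elim: k => [|k IHk]; first by rewrite scale1r.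
  by rewrite -IHk -[in RHS]fE mulmxDl cg -scalemxAl dg scalerA exprSr.
have fd k : mpeval f (w ^+ k *: d) = mpeval f d.
  elim: k => [|k IHk]; first by rewrite scale1r.
  by rewrite -IHk -[in RHS]fE -scalemxAl dg scalerA exprSr.
rewrite -(sum_prim3_cubic c d sf); under eq_bigr do rewrite fcd fd.
by rewrite sumr_const card_ord !mulrS addr0 (addrr_pchar2 K2) addr0 subrK.
Qed.

Lemma beta_sep_mod_S3_ge :
  exists n (rG : mx_representation K [set: 'S_3]%G n), (4 <= beta_sep_mod rG)%N.
Proof.
have actR : [acts [set: 'S_3], on [set: 'S_3] | 'R].
  by apply/actsP => g _ h; rewrite !inE.
have [phi phiE] := @acts_perm_morphism _ [set: 'S_3]%G _ _ _ actR.
have [||rG rGE] := @twisted_perm_repr K _ _ _ phi (fun=> 1).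
- by [].
- by move=> g h _ _; rewrite mulr1.
exists _, rG.
pose vec (F : 'S_3 -> K) := \row_(i < #|[set: 'S_3]|) F (enum_val i).
have vecE F g : vec F *m rG g = vec (fun h => F (h * g^-1)%g).
  rewrite rGE ?inE // scale1r -[X in perm_mx X]invgK -col_permE.
  apply/rowP => i; rewrite !mxE -morphV ?inE //.
  by rewrite phiE ?inE.
(* In the regular representation, [c] is fixed by the 3-cycles but not by the involution, which
   exchanges [al] and [be]. *)
pose c (h : 'S_3) : K := (~~ odd_perm h)%:R.
pose al (h : 'S_3) := w ^+ h ord0.
pose be (h : 'S_3) := w ^+ (- h ord0)%R.
have odd_rho : odd_perm rho3 = false.
  have : odd_perm (rho3 ^+ 3)%g = false.
    suff -> : (rho3 ^+ 3 = 1)%g by rewrite odd_perm1.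
    by apply/eqP; rewrite -order_dvdn rho3_order.
  by rewrite !expgS !odd_permM odd_perm1; case: odd_perm.
have odd_rhoX k : odd_perm (rho3 ^+ k)%g = false.
  by elim: k => [|k IHk]; rewrite ?odd_perm1 // expgS odd_permM odd_rho.
have odd_sigma : odd_perm sigma3 = true.
  suff -> : sigma3 = tperm (1 : 'I_3) (-1) by rewrite odd_tperm.
  apply/permP => i; rewrite permE; case: tpermP => [->|->|]; rewrite ?opprK //.
  by case: i => [[|[|[|//]]] lt_i] /eqP i1 /eqP iN1; apply/val_inj.
have al_rho h : al (h * rho3)%g = w * al h.
  by rewrite /al permM permE prim3_expD mulrC expr1.
have be_rho h : be (h * rho3^-1)%g = w * be h.
  rewrite /be; have -> : h ord0 = (h * rho3^-1)%g ord0 + 1.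
    by rewrite -[RHS](permE (addIr _)) -permM mulgKV.
  by rewrite opprD prim3_expD mulrCA -exprS w3 mulr1.
have vecc g : odd_perm g = false -> vec c *m rG g = vec c.
  by move=> g_even; rewrite vecE /c; apply/rowP => i;
    rewrite !mxE odd_permM odd_permV g_even addbF.
have sep : forall g, g \in [set: 'S_3] ->
  vec c + vec be <> (vec c + vec al) *m rG g.
  move=> g _; rewrite mulmxDl !vecE => /rowP bE.
  have {bE} bE h : c h + be h = c (h * g^-1)%g + al (h * g^-1)%g.
    have := bE (enum_rank_in (in_setT h) h).
    by rewrite !mxE enum_rankK_in ?inE.
  (* At the identity the left side is 1 + 1 = 0. A nontrivial rotation gives 1 + w^k with w^k
     different from 1, and a reflection gives a power of [w]. *)
  have gV1 : (g^-1 = 1)%g.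
    have [k [gVE|gVE]] := S3_elements g^-1.
      have alX : al (rho3 ^+ k)%g = w ^+ k.
        elim: (k) => [|j IHj]; first by rewrite /al expg0 perm1.
        by rewrite expgSr al_rho IHj exprS.
      have := bE 1%g; rewrite mul1g gVE alX /c /be perm1 odd_perm1 odd_rhoX
        oppr0 expr0.
      move/addrI/esym/eqP;
        rewrite -(prim_order_dvd prim_w) -{1}rho3_order order_dvdn.
      by move/eqP.
    have := bE 1%g; rewrite mul1g gVE /c odd_permM odd_sigma addbT.
    rewrite odd_rhoX odd_perm1 /be perm1 oppr0 expr0 (addrr_pchar2 K2) add0r =>
      /esym/eqP.
    by rewrite expf_eq0 (prim_root_eq0 prim_w) andbF.
  have := bE rho3; rewrite gV1 mulg1 => /addrI/eqP.
  by rewrite /be /al permE (eq_prim_root_expr prim_w).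
have [f [fG _] fxx'] := orbit_separation sep.
apply: leq_beta_sep_mod fG fxx' _ => h hG.
(* Both values split off the same contribution of [c]; what remains agrees because the involution
   takes [al] to [be]. *)
rewrite (cubic_invariants_collapse (g := rho3^-1%g) hG); first last.
- rewrite vecE; apply/rowP => i; rewrite !mxE invgK al_rho //.
- by apply: vecc; rewrite odd_permV.
rewrite (cubic_invariants_collapse (g := rho3) hG); first last.
- rewrite vecE; apply/rowP => i; rewrite !mxE be_rho //.
- exact: vecc.
congr (_ + _); have [hinv _] := hG;
  rewrite -(hinv sigma3^-1%g (vec al)) ?inE //.
by congr mpeval; rewrite vecE; apply/rowP => i;
  rewrite !mxE invgK /al permM permE.
Qed.

End LowerBoundS3.

Theorem theoremC (K : closedFieldType) :
  [/\ (2%N \in [pchar K])%R -> beta_sep K [set: 'S_3]%G = Some 4,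
      forall (p : nat) (gT : finGroupType) (G : {group gT}),
        (p \in [pchar K])%R -> (p.-group G)%g -> beta_sep K G = Some #|G|,
      forall (gT : finGroupType) (G : {group gT}),
        cyclic G -> beta_sep K G = Some #|G|
    & forall p r : nat,
        (p \in [pchar K])%R -> odd p -> 0 < r ->
        beta_sep K ('D_(2 * p ^ r)%N)%G = Some (2 * p ^ r)].
Proof.
split=> [K2|p gT G pK pG|gT G|p r pK p_odd r_gt0].
- have [w prim_w] : exists w : K, (3.-primitive_root w)%R.
    by apply: closed_prim_root; rewrite -natf_neq0_pchar -(dvdn_pcharf K2).
  apply: beta_sep_eq => [n rG|]; last exact: beta_sep_mod_S3_ge K2 prim_w.
  exact: beta_sep_mod_S3_le K2 prim_w _ _.
- exact: beta_sep_pgroup pK pG.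
- exact: beta_sep_cyclic.
have p_pr := pcharf_prime pK.
rewrite mul2n; apply: beta_sep_dihedral.
- by rewrite (eq_pnat _ (pcharf_eq pK)) pnatX pnat_id.
- by rewrite -(dvdn_pcharf pK) dvdn_prime2 //; apply: contraTneq p_odd => ->.
- by rewrite (leq_trans (prime_gt1 p_pr)) // -{1}(expn1 p) leq_exp2l ?prime_gt1.
exact: isog_refl.
Qed.
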